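(* Let $k\ge1$. The probability mass function $h_r^{(II)}(n)=P(T_{r,k}^{(II)}=n)$ satisfies, for $r\ge2$ and $n\ge1$, the recursive scheme $$h_{r}^{(II)}(n)=h_{r}^{(II)}(n-1)-p^{k}q\,h_{r}^{(II)}(n-k-1)+p^{k}q\,h_{r-1}^{(II)}(n-k-1),$$ with initial conditions $h_{0}^{(II)}(n)=\delta_{n,0}$ and $$h_{1}^{(II)}(n)=\begin{cases}0 & \text{if } 0\le n<k,\\ p^{k} & \text{if } n=k,\\ p^{k}q & \text{if } n=k+1,\\ h_{1}^{(II)}(n-1)-p^{k}q\,h_{1}^{(II)}(n-k-1) & \text{if } n>k+1.\end{cases}$$
   Context: $(X_i)_{i\ge1}$ is an infinite sequence of independent Bernoulli trials with $P(X_i=1)=p$, $0<p<1$, and $P(X_i=0)=q=1-p$. $T_{r,k}^{(II)}$ is the waiting time until the $r$-th occurrence of a success run under the ''at least $k$'' counting scheme (each maximal block of at least $k$ consecutive ones counts once, at the moment its length reaches $k$): for $r\ge1$ it is the $r$-th smallest index $n\ge k$ such that $X_{n-k+1}=\cdots=X_n=1$ and either $n=k$ or $X_{n-k}=0$; $T_{0,k}^{(II)}=0$. Conventions: $h_r^{(II)}(n)=0$ for $n<0$; $\delta_{n,0}$ is the Kronecker delta. *)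

(* Defs.v *)
From HB Require Import structures.
From mathcomp Require Import all_boot all_order all_algebra finmap.
From mathcomp Require Import all_classical all_reals all_analysis.

Set Implicit Arguments.
Unset Strict Implicit.
Unset Printing Implicit Defensive.

Import Order.TTheory GRing.Theory Num.Theory.

Local Open Scope classical_set_scope.
Local Open Scope ring_scope.

(* The product rule over every finite subfamily of (X i)_{i in I}. *)
Definition mutually_independent (R : realType) (d d' : measure_display)
    (Omega : measurableType d) (P : probability Omega R)
    (E : measurableType d') (I : set nat) (X : nat -> {RV P >-> E}) : Prop :=
  forall (J : {fset nat}) (B : nat -> set E),
    [set` J] `<=` I ->
    (forall i, i \in J -> measurable (B i)) ->
    P (\bigcap_(i in [set` J]) (X i @^-1` B i)) =
    (\prod_(i <- J) P (X i @^-1` B i))%E.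

(* Success is [true] and failure is [false].  The trials are X 1, X 2, ...;
   X 0 is a dummy value on which nothing is assumed. *)
Definition bernoulli_trials (R : realType) (d : measure_display)
    (Omega : measurableType d) (P : probability Omega R) (p : R)
    (X : nat -> {RV P >-> bool}) : Prop :=
  [/\ mutually_independent [set i | (1 <= i)%N] X,
      forall i, (1 <= i)%N -> P (X i @^-1` [set true]) = p%:E
    & forall i, (1 <= i)%N -> P (X i @^-1` [set false]) = (1 - p)%:E].

(* The run of ones x_{n-k+1}, ..., x_n just reaches length k at time n. *)
Definition run_reaches (x : nat -> bool) (k n : nat) : bool :=
  [&& (k <= n)%N, all x (iota (n - k).+1 k) & (n == k) || ~~ x (n - k)%N].

(* The r-th smallest element of A for r >= 1 (the element of A below or at
   which lie exactly r elements of A), [None] if A has fewer than r elements. *)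
Definition nth_smallest (A : pred nat) (r : nat) : option nat :=
  xget None [set Some n | n in [set n | A n /\ count A (iota 0 n.+1) = r]].

(* T_{r,k}^{(II)} along the outcome sequence x; [None] stands for an infinite
   waiting time. *)
Definition waiting_time (x : nat -> bool) (k r : nat) : option nat :=
  if r is 0%N then Some 0%N else nth_smallest (run_reaches x k) r.

(* h_r^{(II)}(n), extended by 0 to n < 0. *)
Definition waiting_pmf (R : realType) (d : measure_display)
    (Omega : measurableType d) (P : probability Omega R)
    (X : nat -> {RV P >-> bool}) (k r : nat) (n : int) : R :=
  match n with
  | Posz m =>
      fine (P [set w | waiting_time (fun i => X i w) k r = Some m])
  | Negz _ => 0
  end.

(* Main.v *)
Require Import Defs.
From HB Require Import structures.
From mathcomp Require Import all_boot all_order all_algebra finmap.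
From mathcomp Require Import all_classical all_reals all_analysis.
From mathcomp Require Import zify ring.

Set Implicit Arguments.
Unset Strict Implicit.
Unset Printing Implicit Defensive.

Import Order.TTheory GRing.Theory Num.Theory.

Local Open Scope classical_set_scope.
Local Open Scope ring_scope.

(* Let N_m be the number of success runs counted up to time m.  For n > k a run
   reaches length k at time n iff X_{n-k} = 0 and X_{n-k+1} = ... = X_n = 1,
   and then no run is counted at the times n-k, ..., n-1.  By independence
   h_r(n) = p^k q P(N_{n-k-1} = r-1).  The recursion is the difference of this
   identity at n and n-1, since splitting on whether a run is counted at time m
   gives P(N_m = r-1) - P(N_{m-1} = r-1) = h_{r-1}(m) - h_r(m). *)

(** * Run counting along a fixed outcome sequence *)

Definition run_count (x : nat -> bool) (k n : nat) : nat :=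
  count (run_reaches x k) (iota 0 n.+1).

(** Functional form of measurability with respect to the trials 1, ..., m. Index 0 is left out
    because nothing is assumed on [X 0]. *)
Definition depends_upto (m : nat) (f : (nat -> bool) -> bool) : Prop :=
  forall x y, (forall i, (1 <= i <= m)%N -> x i = y i) -> f x = f y.

(** The count strictly increases at each element of [A], so at most one element has count [r] and
    the choice made by [xget] is forced. *)
Lemma nth_smallestP (A : pred nat) (r m : nat) :
  nth_smallest A r = Some m <-> A m /\ count A (iota 0 m.+1) = r.
Proof.
split.
  rewrite /nth_smallest; case: xgetP => [y _ [n /= [An cn] yE] yS|_ //].
  by move: yS; rewrite -yE => -[<-].
move=> [Am cm]; apply: xget_unique; first by exists m.
have lt_count i j : A j -> (i < j)%N ->
    (count A (iota 0 i.+1) < count A (iota 0 j.+1))%N.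
  move=> Aj ij; have -> : j.+1 = (i.+1 + (j - i).-1 + 1)%N by lia.
  rewrite !iotaD !count_cat /=.
  have -> : (0 + (i.+1 + (j - i).-1) = j)%N by lia.
  rewrite Aj; lia.
move=> _ [n [An cn] <-]; congr Some.
case: (ltngtP n m) => // nm.
  have := lt_count _ _ Am nm; lia.
have := lt_count _ _ An nm; lia.
Qed.

Lemma run_count_recr x k n :
  run_count x k n.+1 = (run_count x k n + run_reaches x k n.+1)%N.
Proof. by rewrite /run_count -addn1 iotaD count_cat /= addn0. Qed.

Lemma depends_run_reaches k j n : (1 <= k)%N -> (j <= n)%N ->
  depends_upto n (fun x => run_reaches x k j).
Proof.
move=> k1 jn x y xy; rewrite /run_reaches; case: leqP => //= kj; congr (_ && _).
  by apply: eq_in_all => i; rewrite mem_iota => Hi; apply: xy; lia.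
(* The test [j == k] shields [x 0]: past it, [j - k] is at least 1. *)
by case: eqP => //= nk; rewrite xy //; lia.
Qed.

Lemma depends_run_count k n r : (1 <= k)%N ->
  depends_upto n (fun x => run_count x k n == r).
Proof.
move=> k1 x y xy; congr (_ == _); apply: eq_in_count => j; rewrite mem_iota => jn.
by apply: (depends_run_reaches (n := n)) => //; lia.
Qed.

Lemma run_reachesF x k n : (n < k)%N -> run_reaches x k n = false.
Proof. by move=> nk; rewrite /run_reaches leqNgt nk. Qed.

Lemma run_count_eq0 x k n : (n < k)%N -> run_count x k n = 0%N.
Proof.
move=> nk; apply/eqP; rewrite -leqn0 leqNgt -has_count; apply/hasPn => j.
by rewrite mem_iota => jn; rewrite run_reachesF //; lia.
Qed.

Lemma all_map_iota (x : nat -> bool) j l :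
  all x (iota j l) = ([seq x i | i <- iota j l] == nseq l true).
Proof. by elim: l j => //= l IH j; rewrite eqseq_cons IH; case: (x j). Qed.

Lemma run_reaches_first x k :
  run_reaches x k k = ([seq x i | i <- iota 1 k] == nseq k true).
Proof. by rewrite /run_reaches leqnn eqxx subnn andbT all_map_iota. Qed.

(** A time of the form m+k+1 is never k, so a preceding failure is required and the event becomes a
    cylinder: the word 0 1^k at positions m+1, ..., m+k+1. *)
Lemma run_reaches_late x k m : run_reaches x k (m + k.+1) =
  ([seq x i | i <- iota m.+1 k.+1] == false :: nseq k true).
Proof.
rewrite /run_reaches; have -> : (m + k.+1 - k = m.+1)%N by lia.
have -> : (m + k.+1 == k) = false by apply/eqP; lia.
have -> : (k <= m + k.+1)%N by lia.
by rewrite /= eqseq_cons all_map_iota andbC; case: (x m.+1).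
Qed.

(** For j in m+1, ..., m+k the window of length k ending at j contains position m+1, where there is
    a failure, so nothing is counted at these times. *)
Lemma run_count_late x k m : (1 <= k)%N -> run_reaches x k (m + k.+1) ->
  run_count x k (m + k.+1) = (run_count x k m).+1.
Proof.
move=> k1 reach; rewrite addnS run_count_recr -addnS reach addn1; congr S.
rewrite /run_count -addSn iotaD count_cat.
suff -> : count (run_reaches x k) (iota (0 + m.+1) k) = 0%N by rewrite addn0.
apply/eqP; rewrite -leqn0 leqNgt -has_count; apply/hasPn => j.
rewrite mem_iota add0n => Hj; apply/negP => /and3P[kj /allP aj _].
move: reach; rewrite run_reaches_late eqseq_cons => /andP[xm _].
by move: (aj m.+1); rewrite mem_iota (eqP xm); lia.
Qed.

(** * Probabilities of events that depend on finitely many trials *)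

Section Trials.
Context (R : realType) (d : measure_display) (Omega : measurableType d).
Context (P : probability Omega R) (p : R) (X : nat -> {RV P >-> bool}).
Context (X_trials : bernoulli_trials p X).

Definition path_event (f : (nat -> bool) -> bool) : set Omega :=
  [set w | f (fun i => X i w)].
Definition word_prob (s : seq bool) : R := \prod_(b <- s) (if b then p else 1 - p).

Lemma cylinder_event m (s : seq bool) :
  let E := path_event (fun x => [seq x i | i <- iota m.+1 (size s)] == s) in
  measurable E /\ P E = (word_prob s)%:E.
Proof.
move=> E; have [ind Pt Pf] := X_trials.
(* [c i] is the letter prescribed for trial i; the default [false] is never read for i in [J]. *)
pose c i := nth false s (i - m.+1).
pose J := [fset i in iota m.+1 (size s)]%fset.
have JE i : (i \in J) = (m < i < m.+1 + size s)%N by rewrite inE /= mem_iota.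
have EE : E = \bigcap_(i in [set` J]) (X i @^-1` [set c i]).
  apply/seteqP; split => w /=.
    move=> /eqP sE i /=; rewrite JE => Hi; rewrite /c -sE.
    rewrite (nth_map 0%N) ?size_iota ?nth_iota; try lia.
    by congr (X _ w); lia.
  move=> H; apply/eqP/(@eq_from_nth _ false); rewrite size_map size_iota // => i si.
  rewrite (nth_map 0%N) ?size_iota // nth_iota // H /= ?JE /c; last lia.
  by congr nth; lia.
split.
  by rewrite EE; apply: bigcap_measurableType => i _; exact: measurable_funPTI.
rewrite EE ind.
- have sE : s = [seq c i | i <- iota m.+1 (size s)].
    apply: (@eq_from_nth _ false); rewrite ?size_map ?size_iota // => i si.
    by rewrite (nth_map 0%N) ?size_iota // nth_iota // /c addKn.
  rewrite (perm_big (iota m.+1 (size s))) /=; last first.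
    apply: uniq_perm; rewrite ?fset_uniq ?iota_uniq // => i.
    by rewrite JE mem_iota.
  rewrite /word_prob [in RHS]sE big_map -prodEFin big_seq [RHS]big_seq.
  apply: eq_bigr => i; rewrite mem_iota => /andP[Hi _].
  by case: (c i); [rewrite Pt //|rewrite Pf //]; lia.
- by move=> i /=; rewrite JE; lia.
- by [].
Qed.

(* The constant e is P(f), by s = [::]. *)
Lemma path_event_product m f : depends_upto m f -> exists e : R, forall s,
  let E := path_event (fun x =>
    f x && ([seq x i | i <- iota m.+1 (size s)] == s)) in
  measurable E /\ P E = (e * word_prob s)%:E.
Proof.
elim: m f => [|m IH] f fm.
  (* With m = 0 the function [f] is constant, so evaluating it at any sequence gives its
     probability, 0 or 1. *)
  exists (f xpred0)%:R => s E.
  have -> : E = if f xpred0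
      then path_event (fun x => [seq x i | i <- iota 1 (size s)] == s) else set0.
    have fE x : f x = f xpred0 by apply: fm; lia.
    by rewrite /E /path_event; case: ifP => f0;
      apply/seteqP; split => w /=; rewrite fE f0.
  case: (f xpred0); first by rewrite mul1r; exact: cylinder_event.
  by rewrite mul0r measure0.
(* Condition on trial m+1: freezing its value to [b] leaves a function of the first m trials, and
   [b] moves to the front of the word. Freezing it to the value it already has changes nothing. *)
pose fb b x := f (fun i => if i == m.+1 then b else x i).
have fbm b : depends_upto m (fb b).
  by move=> x y xy; apply: fm => i Hi; case: eqP => // im; apply: xy; lia.
have [et Ht] := IH _ (fbm true); have [ef Hf] := IH _ (fbm false).
exists (et * p + ef * (1 - p)) => s E.
have [mt Pt] := Ht (true :: s); have [mf Pf] := Hf (false :: s).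
pose Eb b := path_event (fun x =>
  fb b x && ([seq x i | i <- iota m.+1 (size (b :: s))] == b :: s)).
have EE : E = Eb true `|` Eb false.
  apply/seteqP; rewrite /E /Eb /path_event /fb.
  have ff w b : X m.+1 w = b ->
      f (fun i => if i == m.+1 then b else X i w) = f (fun i => X i w).
    by move=> Xb; congr f; apply/funext => i; case: eqP => // ->.
  split => w /=.
    move=> /andP[fw sw]; case Xm: (X m.+1 w); [left|right];
      by rewrite (ff w _ Xm) fw eqseq_cons sw.
  by case => /andP[fw]; rewrite eqseq_cons => /andP[/eqP Xm sw];
    rewrite -(ff w _ Xm) fw sw.
rewrite EE; split; first exact: measurableU.
rewrite measureU //; last first.
  apply/seteqP; split => // w []; rewrite /Eb /path_event /= !eqseq_cons.
  by move=> /andP[_ /andP[/eqP -> _]] /andP[_].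
rewrite [X in (X + _)%E]Pt [X in (_ + X)%E]Pf -EFinD /word_prob !big_cons.
congr EFin; ring.
Qed.

Definition path_prob f : R := fine (P (path_event f)).

Lemma path_prob_eq f g : f =1 g -> path_prob f = path_prob g.
Proof. by move=> /funext ->. Qed.

Lemma path_prob_event m f s : depends_upto m f ->
  path_prob (fun x => f x && ([seq x i | i <- iota m.+1 (size s)] == s)) =
  path_prob f * word_prob s.
Proof.
move=> /path_event_product[e H]; rewrite /path_prob; have [_ ->] := H s.
have [_] := H [::]; rewrite /word_prob big_nil mulr1.
under [X in path_event X]funext do rewrite andbT.
by move=> ->.
Qed.

Lemma measurable_path_event m f : depends_upto m f -> measurable (path_event f).
Proof.
move=> /path_event_product[e H]; have [+ _] := H [::].
by under [X in path_event X]funext do rewrite andbT.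
Qed.

Lemma path_prob_split m f g : depends_upto m f -> depends_upto m g ->
  path_prob f =
  path_prob (fun x => f x && g x) + path_prob (fun x => f x && ~~ g x).
Proof.
move=> fm gm; rewrite /path_prob.
have m1 : measurable (path_event (fun x => f x && g x)).
  apply: (measurable_path_event (m := m)) => x y xy.
  by rewrite (fm _ _ xy) (gm _ _ xy).
have m2 : measurable (path_event (fun x => f x && ~~ g x)).
  apply: (measurable_path_event (m := m)) => x y xy.
  by rewrite (fm _ _ xy) (gm _ _ xy).
rewrite -fineD ?fin_num_measure // -measureU //; last first.
  apply/seteqP; split => // w []; rewrite /path_event /=.
  by move=> /andP[_ ->]; rewrite andbF.
congr (fine (P _)); apply/seteqP; split => w; rewrite /path_event /=.
  by move=> ->; case: (g _); [left|right].
by case=> /andP[].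
Qed.

Lemma path_prob0 : path_prob (fun=> false) = 0.
Proof.
rewrite /path_prob (_ : path_event _ = set0) ?measure0 //.
by apply/seteqP; split.
Qed.

Lemma path_prob1 : path_prob (fun=> true) = 1.
Proof.
rewrite /path_prob (_ : path_event _ = setT) ?probability_setT //.
by apply/seteqP; split.
Qed.

(** * The law of the waiting time *)

Context (k : nat) (k_ge1 : (1 <= k)%N).

(** For r >= 1 this is h_r(n). At r = 0 it differs from h_0, which has mass 1 at 0; this choice
    makes the recursion for h_1 an instance of the general one. *)
Definition run_pmf (r n : nat) : R :=
  path_prob (fun x => run_reaches x k n && (run_count x k n == r)).

Lemma waiting_pmfE r n : waiting_pmf X k r.+1 (Posz n) = run_pmf r.+1 n.
Proof.
congr (fine (P _)); apply/seteqP; split => w; rewrite /path_event /=.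
  by move=> /nth_smallestP[rw cw]; rewrite rw /run_count cw eqxx.
by move=> /andP[rw /eqP cw]; apply/nth_smallestP.
Qed.

Lemma run_pmf_early r n : (n < k)%N -> run_pmf r n = 0.
Proof.
by move=> nk; rewrite -path_prob0; apply: path_prob_eq => x; rewrite run_reachesF.
Qed.

Lemma word_prob_ones : word_prob (nseq k true) = p ^+ k.
Proof. by rewrite /word_prob big_nseq -Monoid.iteropE. Qed.

Lemma run_pmf_first r : run_pmf r k = (r == 1%N)%:R * p ^+ k.
Proof.
have count_k x : run_reaches x k k -> run_count x k k = 1%N.
  by case: k k_ge1 => // k' _ reach; rewrite run_count_recr reach run_count_eq0.
have -> : run_pmf r k = path_prob (fun x => (r == 1%N) && run_reaches x k k).
  apply: path_prob_eq => x; rewrite andbC eq_sym.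
  by case: (boolP (run_reaches x k k)) => [/count_k ->|]; rewrite ?andbF // eq_sym.
(* The constant condition [r == 1] is an event of the first 0 trials, so the product formula applies
   with m = 0. *)
have r1 : depends_upto 0 (fun=> r == 1%N) by [].
rewrite -word_prob_ones.
have := path_prob_event (nseq k true) r1; rewrite size_nseq => path_prob_cyl.
under [LHS]path_prob_eq => x do rewrite run_reaches_first.
rewrite path_prob_cyl; congr (_ * _).
by case: (r == 1%N); [exact: path_prob1|exact: path_prob0].
Qed.

Lemma run_pmf_late r m :
  run_pmf r.+1 (m + k.+1) =
  path_prob (fun x => run_count x k m == r) * (p ^+ k * (1 - p)).
Proof.
have -> : p ^+ k * (1 - p) = word_prob (false :: nseq k true).
  by rewrite /word_prob big_cons -/(word_prob _) word_prob_ones mulrC.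
rewrite -(path_prob_event _ (depends_run_count r k_ge1)); apply: path_prob_eq => x.
rewrite /= size_nseq -/(iota m.+1 k.+1) -map_cons -run_reaches_late andbC.
by case: (boolP (run_reaches x k _)) => [/(run_count_late k_ge1) ->|]; rewrite ?andbF.
Qed.

Lemma count_step r m : path_prob (fun x => run_count x k m.+1 == r) =
  path_prob (fun x => run_count x k m == r) + run_pmf r m.+1 - run_pmf r.+1 m.+1.
Proof.
have dc := @depends_run_count k _ _ k_ge1.
have dr := depends_run_reaches k_ge1 (leqnn m.+1).
(* Both counting events are split on [run_reaches x k m.+1]; their parts without a run at m+1
   coincide and cancel. *)
rewrite (path_prob_split (dc m.+1 r) dr).
rewrite (@path_prob_split m.+1 (fun x => run_count x k m == r) _ _ dr); last first.
  by move=> x y xy; apply: (dc m r) => i Hi; apply: xy; lia.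
have -> : path_prob (fun x => (run_count x k m.+1 == r)
    && run_reaches x k m.+1) = run_pmf r m.+1.
  by apply: path_prob_eq => x; rewrite andbC.
have -> : path_prob (fun x => (run_count x k m == r)
    && run_reaches x k m.+1) = run_pmf r.+1 m.+1.
  apply: path_prob_eq => x; rewrite andbC run_count_recr.
  by case: run_reaches; rewrite // addn1 eqSS.
have -> : path_prob (fun x => (run_count x k m.+1 == r)
      && ~~ run_reaches x k m.+1) =
    path_prob (fun x => (run_count x k m == r) && ~~ run_reaches x k m.+1).
  apply: path_prob_eq => x; rewrite run_count_recr.
  by case: run_reaches; rewrite ?andbF ?addn0.
ring.
Qed.

Lemma run_pmf_recr r m : run_pmf r.+1 (m.+1 + k.+1) = run_pmf r.+1 (m + k.+1)
  - p ^+ k * (1 - p) * run_pmf r.+1 m.+1 + p ^+ k * (1 - p) * run_pmf r m.+1.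
Proof. by rewrite !run_pmf_late count_step; ring. Qed.

(** A run counted at a time is included in the count at that time. This removes the last term of the
    recursion at r = 0, leaving the shorter one for h_1. *)
Lemma run_pmf0 m : run_pmf 0%N m.+1 = 0.
Proof.
rewrite -path_prob0; apply: path_prob_eq => x; rewrite run_count_recr.
by case: run_reaches; rewrite // addn1.
Qed.

End Trials.

Theorem theorem3p4 (R : realType) (d : measure_display)
    (Omega : measurableType d) (P : probability Omega R)
    (p q : R) (p_gt0 : 0 < p) (p_lt1 : p < 1) (qE : q = 1 - p)
    (X : nat -> {RV P >-> bool}) (X_trials : bernoulli_trials p X)
    (k : nat) (k_ge1 : (1 <= k)%N) :
  let h := waiting_pmf X k in
  [/\ forall (r : nat) (n : int), (2 <= r)%N -> 1 <= n ->
        h r n = h r (n - 1) - p ^+ k * q * h r (n - k%:Z - 1)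
                + p ^+ k * q * h r.-1 (n - k%:Z - 1),
      forall n : int, h 0%N n = (n == 0)%:R
    & [/\ forall n : int, 0 <= n -> n < k%:Z -> h 1%N n = 0,
          h 1%N k%:Z = p ^+ k,
          h 1%N (k%:Z + 1) = p ^+ k * q
        & forall n : int, k%:Z + 1 < n ->
            h 1%N n = h 1%N (n - 1) - p ^+ k * q * h 1%N (n - k%:Z - 1)]].
Proof.
move=> h; subst q.
have h_early r (n : int) : n < k%:Z -> h r.+1 n = 0.
  case: n => // n nk; rewrite /h waiting_pmfE; apply: run_pmf_early; lia.
have h_first r : h r.+1 k%:Z = (r == 0%N)%:R * p ^+ k.
  by rewrite /h waiting_pmfE (run_pmf_first X_trials k_ge1).
have h_late r : h r.+1 (k%:Z + 1) = (r == 0%N)%:R * (p ^+ k * (1 - p)).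
  (* This is [run_pmf_late] with m = 0: the count at time 0 is 0, so only the first run has mass
     here. *)
  have -> : k%:Z + 1 = Posz (0 + k.+1) by lia.
  rewrite /h waiting_pmfE (run_pmf_late X_trials k_ge1); congr (_ * _).
  under [LHS]path_prob_eq => x do rewrite run_count_eq0 //.
  by case: r; [exact: path_prob1|move=> r; exact: path_prob0].
split.
- move=> [|[|r]] // n _ n1; rewrite [_.-1]/=.
  (* [run_pmf_recr] compares two times that are both at least k+1, so it starts at n = k+2. For n up
     to k+1 every term vanishes: a second run cannot reach length k that early, and n-k-1 is at most
     0. *)
  have [nk|kn|->] := ltgtP n (k%:Z + 1).
  + rewrite !(h_early _ (n - k%:Z - 1)) ?(h_early _ (n - 1)); try lia.
    rewrite !mulr0 subr0 addr0.
    by have [/h_early -> //|nk'|->] := ltgtP n k%:Z; [lia|rewrite h_first mul0r].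
  + have [m nE] : exists m : nat, n = Posz (m.+1 + k.+1).
      by exists (`|n| - k.+2)%N; lia.
    have -> : n - 1 = Posz (m + k.+1) by lia.
    have -> : n - k%:Z - 1 = Posz m.+1 by lia.
    by rewrite nE /h !waiting_pmfE (run_pmf_recr X_trials k_ge1).
  + have -> : k%:Z + 1 - 1 = k%:Z by lia.
    rewrite h_late h_first !h_early; try lia.
    by rewrite !mul0r !mulr0 subr0 addr0.
- case=> [n|n] //=; rewrite /h /=.
  case: n => [|n].
    by rewrite (_ : [set _ | _] = setT) ?probability_setT //; apply/seteqP; split.
  by rewrite (_ : [set _ | _] = set0) ?measure0 //; apply/seteqP; split.
- split.
  + by move=> n _; exact: h_early.
  + by rewrite h_first mul1r.
  + by rewrite h_late mul1r.
  + move=> n kn; have [m nE] : exists m : nat, n = Posz (m.+1 + k.+1).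
      by exists (`|n| - k.+2)%N; lia.
    have -> : n - 1 = Posz (m + k.+1) by lia.
    have -> : n - k%:Z - 1 = Posz m.+1 by lia.
    by rewrite nE /h !waiting_pmfE (run_pmf_recr X_trials k_ge1) run_pmf0 // mulr0 addr0.
Qed.
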